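(* Every generalized Petersen graph $GP(k,2)$ with $k \ge 5$ contains an induced claw. Moreover, for every $k \ge 5$ divisible by $5$, $$\gamma(GP(k,2)) = \gamma_e(GP(k,2)) = \tfrac{3}{5}k.$$
   Context: Graphs are finite, simple and undirected. For $k \ge 5$, the graph $GP(k,2)$ has the $2k$ vertices $u_0,\dots,u_{k-1},v_0,\dots,v_{k-1}$ and the edges $u_iu_{i+1}$, $u_iv_i$ and $v_iv_{i+2}$ for all $i$, with indices modulo $k$. A claw is the complete bipartite graph $K_{1,3}$. The domination number $\gamma(G)$ is the minimum size of a set $S$ of vertices such that every vertex outside $S$ has a neighbour in $S$. A matching is a set of edges no two of which share a vertex; it is maximal if no edge of $G$ can be added to it. The edge domination number $\gamma_e(G)$ is the minimum size of a maximal matching of $G$. *)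

(* Defs.v *)
(* MathComp.  A graph on a finite type T is given by its adjacency relation
   e : rel T, which is symmetric and irreflexive for a simple graph. *)
From mathcomp Require Import all_boot.
From mathcomp Require Import zify.

Set Implicit Arguments.
Unset Strict Implicit.
Unset Printing Implicit Defensive.

Section Graphs.
Variables (T : finType) (e : rel T).
Implicit Types (S : {set T}) (M : {set {set T}}).

Definition dominating S : bool :=
  [forall x, (x \notin S) ==> [exists y in S, e x y]].

Lemma ex_dominating : exists n, [exists S, dominating S && (#|S| == n)].
Proof.
exists #|[set: T]|; apply/existsP; exists setT; rewrite eqxx andbT.
by apply/forallP=> x; rewrite in_setT.
Qed.

Definition domination_number : nat := ex_minn ex_dominating.

Definition edge_set : {set {set T}} :=
  [set [set x; y] | x in T, y in T & e x y].

Definition matching M : bool := (M \subset edge_set) && trivIset M.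

Definition maximal_matching M : bool :=
  matching M && [forall f in edge_set :\: M, ~~ matching (f |: M)].

Lemma ex_maximal_matching :
  exists n, [exists M, maximal_matching M && (#|M| == n)].
Proof.
have m0 : matching set0.
  by rewrite /matching sub0set; apply/trivIsetP=> A B; rewrite inE.
have [M /maxsetP[mM maxM] _] := maxset_exists m0.
exists #|M|; apply/existsP; exists M; rewrite eqxx andbT /maximal_matching mM.
apply/forall_inP=> f; rewrite inE => /andP[fM _]; apply/negP=> mfM.
by rewrite -(maxM _ mfM (subsetUr _ _)) setU11 in fM.
Qed.

Definition edge_domination_number : nat := ex_minn ex_maximal_matching.

End Graphs.

Definition has_induced (U T : finType) (h : rel U) (e : rel T) : Prop :=
  exists2 f : U -> T, injective f & forall x y, e (f x) (f y) = h x y.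

Definition complete_bipartite (m n : nat) : rel ('I_m + 'I_n)%type :=
  fun x y => match x, y with
             | inl _, inr _ | inr _, inl _ => true
             | _, _ => false
             end.

Arguments complete_bipartite : clear implicits.

Definition claw := complete_bipartite 1 3.

(* inl i is the vertex u_i and inr i is the vertex v_i. *)
Definition GP2 (k : nat) : rel ('I_k + 'I_k)%type :=
  fun x y => match x, y with
             | inl i, inl j => (j == i + 1 %[mod k]) || (i == j + 1 %[mod k])
             | inl i, inr j | inr j, inl i => i == j
             | inr i, inr j => (j == i + 2 %[mod k]) || (i == j + 2 %[mod k])
             end.

Arguments GP2 : clear implicits.

Lemma GP2_sym k : symmetric (GP2 k).
Proof. by move=> [i|i] [j|j] //=; rewrite orbC. Qed.

Lemma GP2_irr k : 5 <= k -> irreflexive (GP2 k).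
Proof.
move=> k5 [i|i] //=; rewrite orbb -{1}[nat_of_ord i]addn0 eqn_modDl;
  by rewrite mod0n modn_small //; lia.
Qed.

(* Main.v *)
Require Import Defs.
From mathcomp Require Import all_boot all_order all_algebra.
From mathcomp Require Import zify.
Import GRing.Theory Num.Theory.

(** Write k for the number of columns {u_i, v_i}.

    Lower bound for edge domination: the vertices missed by a maximal matching M
    are independent, and each of the 2|M| covered vertices has a covered
    neighbour, so counting edges gives 3 (2k - 2|M|) <= 2 * 2|M|.

    Lower bound for domination: read a dominating set S as a cyclic sequence of
    columns.  There is a potential V on windows of four consecutive columns such
    that sliding the window by one column with w elements of S changes V by at
    most 5w - 3; summing around the cycle, V cancels and 3k <= 5|S|.

    Upper bounds, when 5 divides k: the matching with edges u_0 u_1, u_3 v_3,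
    v_2 v_4, repeated with period 5, is maximal, and the endpoints u_0, u_3, v_4
    of its edges form a dominating set. *)

(** * Domination and maximal matchings in arbitrary finite graphs *)

Section GraphBounds.
Variables (T : finType) (e : rel T).
Hypotheses (e_sym : symmetric e) (e_irr : irreflexive e).

Lemma domination_number_leq S : dominating e S -> domination_number e <= #|S|.
Proof.
move=> domS; rewrite /domination_number; case: ex_minnP => n _; apply.
by apply/existsP; exists S; rewrite domS eqxx.
Qed.

Lemma domination_number_witness :
  exists2 S, dominating e S & #|S| = domination_number e.
Proof.
rewrite /domination_number; case: ex_minnP => n /existsP[S /andP[domS /eqP]] cardS _.
by exists S.
Qed.

Lemma edge_domination_number_leq M :
  maximal_matching e M -> edge_domination_number e <= #|M|.
Proof.
move=> maxM; rewrite /edge_domination_number; case: ex_minnP => n _; apply.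
by apply/existsP; exists M; rewrite maxM eqxx.
Qed.

Lemma edge_domination_number_witness :
  exists2 M, maximal_matching e M & #|M| = edge_domination_number e.
Proof.
rewrite /edge_domination_number.
by case: ex_minnP => n /existsP[M /andP[maxM /eqP]] cardM _; exists M.
Qed.

Lemma in_edge_set x y : e x y -> [set x; y] \in edge_set e.
Proof. by move=> exy; apply/imset2P; exists x y; rewrite ?inE. Qed.

Lemma edge_setP f : f \in edge_set e -> exists x y, e x y /\ f = [set x; y].
Proof. by case/imset2P=> x y _; rewrite !inE => /andP[_ exy] ->; exists x, y. Qed.

Lemma mem_cover (M : {set {set T}}) f x : f \in M -> x \in f -> x \in cover M.
Proof. by move=> fM xf; apply/bigcupP; exists f. Qed.

Lemma card_cover_matching M : matching e M -> #|cover M| = #|M|.*2.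
Proof.
case/andP=> /subsetP sME /eqP <-; rewrite -muln2 -sum_nat_const.
apply: eq_bigr => f /sME/edge_setP[x [y [exy ->]]].
by rewrite cards2; case: eqP exy => // ->; rewrite e_irr.
Qed.

Lemma matching_cover_neighbor M x :
  matching e M -> x \in cover M -> exists2 y, y \in cover M & e x y.
Proof.
case/andP=> /subsetP sME _ /bigcupP[f fM].
have [a [b [eab fE]]] := edge_setP _ (sME f fM).
rewrite fE !inE => /orP[]/eqP->; [exists b|exists a; rewrite 1?e_sym];
  rewrite ?eab //; by apply: mem_cover fM _; rewrite fE !inE eqxx ?orbT.
Qed.

(** If both ends were uncovered, the edge would be disjoint from every member of [M] and could be
    added. *)
Lemma maximal_matching_cover M x y :
  maximal_matching e M -> e x y -> (x \in cover M) || (y \in cover M).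
Proof.
case/andP=> /andP[sME tM] /forall_inP maxM exy.
apply: contraT; rewrite negb_or => /andP[xM yM].
have disj g : g \in M -> [disjoint [set x; y] & g].
  move=> gM; rewrite disjoint_subset; apply/subsetP=> z; rewrite !inE.
  by case/orP=> /eqP->; [apply: contra xM|apply: contra yM] => zg;
    apply: mem_cover gM zg.
have fM : [set x; y] \notin M.
  by apply: contra xM => fM; apply: mem_cover fM _; rewrite !inE eqxx.
have /negP[] : ~~ matching e ([set x; y] |: M).
  by apply: maxM; rewrite inE fM in_edge_set.
rewrite /matching subUset sub1set in_edge_set // sME /=.
apply/trivIsetP=> A B; rewrite !inE => /orP[/eqP->|AM] /orP[/eqP->|BM].
- by rewrite eqxx.
- by move=> _; apply: disj.
- by move=> _; rewrite disjoint_sym; apply: disj.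
by move/trivIsetP: tM; apply.
Qed.

Lemma regular_edge_domination d : (forall x, #|[set y | e x y]| = d.+1) ->
  d.+1 * #|T| <= d.*2.+1 * (edge_domination_number e).*2.
Proof.
move=> reg; have [M maxM <-] := edge_domination_number_witness.
have mM := proj1 (andP maxM); rewrite -card_cover_matching //.
set C := cover M; rewrite -(cardsC C).
suff: #|~: C| * d.+1 <= #|C| * d by nia.
rewrite -!sum_nat_const.
(* The double sum counts edges between [~: C] and [C]. Uncovered vertices are independent, so each
   contributes its full degree [d.+1]. *)
apply: (@leq_trans (\sum_(x in ~: C) \sum_(y in C) e x y)).
  apply: leq_sum => x; rewrite inE => xC; rewrite -(reg x) -sum1_card.
  rewrite [leqRHS](bigID (e x)) /= [X in _ <= X + _](eq_bigr (fun=> 1)); last first.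
    by move=> y /andP[_ ->].
  apply: leq_trans (leq_addr _ _); rewrite leq_eqVlt; apply/orP; left; apply/eqP.
  apply: eq_bigl => y; rewrite !inE andbC; case exy: (e x y) => //=.
  have := maximal_matching_cover _ _ _ maxM exy.
  by rewrite -/C (negPf xC) /= => yC; rewrite yC.
rewrite exchange_big /=; apply: leq_sum => y yC.
have [z zC eyz] := matching_cover_neighbor _ _ mM yC.
(* One of the [d.+1] neighbours of [y] is the covered vertex [z], so at most [d] are uncovered. *)
have := reg y; rewrite (cardsD1 z) inE eyz => -[<-].
rewrite -sum1_card [leqRHS]big_mkcond [leqLHS]big_mkcond /=.
apply: leq_sum => x _; rewrite !inE e_sym; case: (boolP (x \in C)) => //= xC.
by case: (eqVneq x z) xC => [->|_]; rewrite ?zC //; case: (e y x).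
Qed.

(** A matching is encoded by the involution [p] swapping the ends of each edge and fixing uncovered
    vertices. Since [S] meets every 2-cycle, the edges are the sets [E x] with [x] in [S], hence at
    most [#|S|] many. *)
Lemma edge_domination_involution (p : T -> T) (S : {set T}) : involutive p ->
  (forall x, p x != x -> e x (p x)) ->
  (forall x, p x != x -> (x \in S) || (p x \in S)) ->
  (forall x, x \in S -> p x != x) ->
  (forall x y, e x y -> (p x != x) || (p y != y)) ->
  edge_domination_number e <= #|S|.
Proof.
move=> pK ep Sp pS cov; pose E x := [set x; p x].
apply: leq_trans (leq_imset_card E [in S]); apply: edge_domination_number_leq.
have Ep x : E (p x) = E x by rewrite /E pK setUC.
have EP x y : x \in E y -> E x = E y by rewrite !inE => /orP[]/eqP->.
have inM x : p x != x -> E x \in E @: S.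
  by move=> /Sp/orP[] xS; [|rewrite -Ep]; apply: imset_f.
apply/andP; split.
  apply/andP; split.
    by apply/subsetP=> _ /imsetP[x /pS/ep exy ->]; apply: in_edge_set.
  apply/trivIsetP=> _ _ /imsetP[x _ ->] /imsetP[y _ ->].
  apply: contraNT => /pred0Pn[z /andP[/EP zx /EP zy]].
  by rewrite -zx -zy.
apply/forall_inP=> f /setDP[/edge_setP[x [y [exy ->]]] fM].
(* The new edge has an end [z] already covered by [E z], so it meets a different edge of the
   matching. *)
have [z zf pz] : exists2 z, z \in [set x; y] & p z != z.
  by case/orP: (cov _ _ exy) => pz; [exists x|exists y]; rewrite ?inE ?eqxx ?orbT.
apply/negP=> /andP[_ /trivIsetP triv].
have := triv [set x; y] (E z); rewrite !inE eqxx inM // orbT => /(_ isT isT).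
have fE : [set x; y] != E z by apply: contraNneq fM => ->; apply: inM.
by move=> /(_ fE)/pred0P/(_ z); rewrite /= zf !inE eqxx.
Qed.

End GraphBounds.

(* The a's and b's say which of the vertices u and v of columns 0 to 3 belong to
   a set S (a0 is irrelevant), a4 and b4 describe a possible next column, and the
   two tests say that S dominates both vertices of column 2.  The value is the
   largest total of 3 - 5w, where w counts the elements of S in an added column,
   over all valid continuations by at most n columns. *)
Fixpoint surplus (n : nat) (a1 a2 a3 b0 b1 b2 b3 : bool) : nat :=
  if n is n'.+1 then
    foldr maxn 0
      [seq if [|| a1, a2, a3 | b2] && [|| b0, b2, b4 | a2]
           then 3 + surplus n' a2 a3 a4 b1 b2 b3 b4 - 5 * (a4 + b4) else 0
      | a4 <- [:: false; true], b4 <- [:: false; true]]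
  else 0.

(** The column [(a4, b4)] is one choice in the maximum defining [surplus n.+1]; truncated
    subtraction only rounds up, which preserves the inequality. *)
Lemma surplusS n a1 a2 a3 a4 b0 b1 b2 b3 b4 :
  [|| a1, a2, a3 | b2] -> [|| b0, b2, b4 | a2] ->
  3 + surplus n a2 a3 a4 b1 b2 b3 b4
    <= 5 * (a4 + b4) + surplus n.+1 a1 a2 a3 b0 b1 b2 b3.
Proof.
rewrite -leq_subLR /= => -> hb.
by case: a4; case: b4 hb => /= ->; rewrite !leq_max leqnn ?orbT.
Qed.

(* Value iteration stabilises: this is where 3/5 is seen to bound the mean
   weight of a dominating sequence of columns from below. *)
Lemma surplus_stable a1 a2 a3 b0 b1 b2 b3 :
  surplus 6 a1 a2 a3 b0 b1 b2 b3 = surplus 5 a1 a2 a3 b0 b1 b2 b3.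
Proof.
by case: a1; case: a2; case: a3; case: b0; case: b1; case: b2; case: b3; vm_compute.
Qed.

(** Stability makes horizons 5 and 6 agree, so the one-step inequality holds for the single function
    [surplus 5]. *)
Lemma window_potential :
  exists V : bool -> bool -> bool -> bool -> bool -> bool -> bool -> nat,
  forall a1 a2 a3 a4 b0 b1 b2 b3 b4,
    [|| a1, a2, a3 | b2] -> [|| b0, b2, b4 | a2] ->
    3 + V a2 a3 a4 b1 b2 b3 b4 <= 5 * (a4 + b4) + V a1 a2 a3 b0 b1 b2 b3.
Proof.
exists (surplus 5) => a1 a2 a3 a4 b0 b1 b2 b3 b4 ha hb.
by rewrite -[surplus 5 a1 _ _ _ _ _ _]surplus_stable; apply: surplusS.
Qed.

Lemma sum_periodic n p (F : nat -> nat) :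
  p %| n -> p * \sum_(i < n) F (i %% p) = n * \sum_(r < p) F r.
Proof.
case/dvdnP=> m ->; rewrite mulnAC mulnC; congr (_ * _).
elim: m => [|m IHm]; first by rewrite mul0n big_ord0.
rewrite mulSn big_split_ord /= mulSn -IHm; congr (_ + _); apply: eq_bigr => i _.
  by rewrite modn_small.
by rewrite modnDl.
Qed.

(* The number of columns is written n.+2 so that 'I_n.+2 is the ring Z/(n+2). *)
Section GP2.
Variable n : nat.
Notation k := n.+2.
Notation G := (GP2 k).
Hypothesis k_ge5 : 5 <= k.
Implicit Types (i j : 'I_k).
Local Open Scope ring_scope.

(** * Adjacency in $GP(k,2)$ as equations in the ring $Z/k$ *)

Lemma ord_eq_natr_add i j c : (j == i + c %[mod k])%N = (j == i + c%:R).
Proof. by rewrite -val_eqE /= Zp_nat /= modnDmr modn_small. Qed.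

Lemma GP2_outer i j : G (inl i) (inl j) = (j == i + 1) || (i == j + 1).
Proof. by rewrite /= !ord_eq_natr_add. Qed.

Lemma GP2_inner i j : G (inr i) (inr j) = (j == i + 2%:R) || (i == j + 2%:R).
Proof. by rewrite /= !ord_eq_natr_add. Qed.

Lemma GP2_spoke i j :
  (G (inl i) (inr j) = (i == j)) * (G (inr i) (inl j) = (i == j)).
Proof. by rewrite /= eq_sym. Qed.

Lemma natr_ord_neq0 c : (0 < c < 5)%N -> (c%:R : 'I_k) != 0.
Proof. by move=> c5; rewrite -val_eqE /= Zp_nat /= modn_small; lia. Qed.

Lemma sum_translate (F : 'I_k -> nat) i0 :
  (\sum_i F (i + i0)%R = \sum_i F i)%N.
Proof. by rewrite [RHS](reindex_inj (addIr i0)). Qed.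

(** * Lower bound for the domination number *)

Lemma dominating_outer S i : dominating G S ->
  [|| inl (i + 1) \in S, inl (i + 2%:R) \in S, inl (i + 3%:R) \in S
    | inr (i + 2%:R) \in S].
Proof.
move/forallP/(_ (inl (i + 2%:R))); rewrite implyNb.
case/orP=> [->|/exists_inP[[j|j] jS]]; rewrite ?orbT //.
  rewrite GP2_outer -addrA -mulrSr => /orP[/eqP<-|]; first by rewrite jS !orbT.
  by rewrite mulrSr addrA (can_eq (addrK 1)) => /eqP->; rewrite jS.
by rewrite GP2_spoke => /eqP->; rewrite jS !orbT.
Qed.

Lemma dominating_inner S i : dominating G S ->
  [|| inr i \in S, inr (i + 2%:R) \in S, inr (i + 4%:R) \in S
    | inl (i + 2%:R) \in S].
Proof.
move/forallP/(_ (inr (i + 2%:R))); rewrite implyNb.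
case/orP=> [->|/exists_inP[[j|j] jS]]; rewrite ?orbT //.
  by rewrite GP2_spoke => /eqP->; rewrite jS !orbT.
rewrite GP2_inner -addrA -natrD => /orP[/eqP<-|]; first by rewrite jS !orbT.
by rewrite (can_eq (addrK 2%:R)) => /eqP->; rewrite jS.
Qed.

Lemma dominating_GP2_leq S : dominating G S -> (3 * k <= 5 * #|S|)%N.
Proof.
have [V VP] := window_potential.
move=> domS; pose a i : bool := inl i \in S; pose b i : bool := inr i \in S.
pose phi i := V (a (i + 1)) (a (i + 2%:R)) (a (i + 3%:R))
  (b i) (b (i + 1)) (b (i + 2%:R)) (b (i + 3%:R)).
have cardS : #|S| = (\sum_i (a i + b i))%N.
  by rewrite -sum1_card big_mkcond big_sumType /= -big_split.
have step i : (3 + phi (i + 1)%R <= (a (i + 4%:R)%R + b (i + 4%:R)%R) * 5 + phi i)%N.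
  rewrite mulnC /phi -!addrA -(mulrSr 1 1) -!mulrS.
  by apply: VP; [apply: dominating_outer|apply: dominating_inner].
(* Summed over the cycle, both [phi] terms have the same total by translation and cancel. *)
have := @leq_sum _ (index_enum 'I_k) xpredT _ _ (fun i _ => step i).
rewrite 2!big_split /= -big_distrl /=.
rewrite (sum_translate phi) (sum_translate (fun i => a i + b i)%N) -cardS leq_add2r.
by rewrite sum_nat_const card_ord mulnC (mulnC 5).
Qed.

(** * Regularity and the induced claw *)

Lemma GP2_cubic x : #|[set y | G x y]| = 3.
Proof.
have shift2 c (i : 'I_k) : c + c != 0 -> i - c != i + c.
  by apply: contra_neq => /addrI/eqP; rewrite eq_sym -addr_eq0 => /eqP.
case: x => i.
  rewrite (_ : [set y | _] = inr i |: [set inl (i - 1); inl (i + 1)]).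
    rewrite cardsU1 cards2 !inE (inj_eq inl_inj) shift2 //.
    by rewrite -mulr2n natr_ord_neq0.
  apply/setP=> -[j|j]; rewrite !inE ?GP2_spoke ?GP2_outer /=.
    by rewrite !(inj_eq inl_inj) orbC -subr_eq (eq_sym j).
  by rewrite (inj_eq inr_inj) !orbF eq_sym.
rewrite (_ : [set y | _] = inl i |: [set inr (i - 2%:R); inr (i + 2%:R)]).
  rewrite cardsU1 cards2 !inE (inj_eq inr_inj) shift2 //.
  by rewrite -natrD natr_ord_neq0.
apply/setP=> -[j|j]; rewrite !inE ?GP2_spoke ?GP2_inner /=.
  by rewrite (inj_eq inl_inj) !orbF eq_sym.
by rewrite !(inj_eq inr_inj) orbC -subr_eq (eq_sym j).
Qed.

Lemma GP2_has_claw : has_induced claw G.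
Proof.
have neq0 c : (0 < c < 5)%N -> (c%:R == 0 :> 'I_k) = false.
  by move=> c5; apply/negbTE/natr_ord_neq0.
(* The claw has centre $u_0$ and leaves $u_1$, $u_{-1}$, $v_0$. *)
pose f (x : 'I_1 + 'I_3) : 'I_k + 'I_k := match x with
  | inl _ => inl 0
  | inr (@Ordinal _ 0 _) => inl 1
  | inr (@Ordinal _ 1 _) => inl (- 1)
  | inr _ => inr 0
  end.
have one0 : (1 == 0 :> 'I_k) = false := neq0 1 isT.
(* The equalities $-1 = 1$ and $-1 = 2$ would give $2 = 0$ and $3 = 0$ in $Z/k$, excluded by $k \ge
   5$. *)
have oppE : ((- 1 == 0 :> 'I_k) = false) * ((- 1 == 1 :> 'I_k) = false)
    * ((- 1 == 1 + 1 :> 'I_k) = false) * ((1 == 1 + 1 :> 'I_k) = false).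
  rewrite oppr_eq0 one0 !(eq_sym (- 1)) -!addr_eq0 -(natrD _ 1 1) -(natrD _ 2 1).
  by rewrite !neq0 // eq_sym -subr_eq0 addrK one0.
exists f.
  move=> [x|[[|[|[|//]]] x]] [y|[[|[|[|//]]] y]]; rewrite /f => /eqP;
    rewrite ?(inj_eq inl_inj) ?(inj_eq inr_inj) ?[0 == _]eq_sym ?[1 == _]eq_sym
            ?one0 ?oppE //= => _; try by congr inr; apply: val_inj.
  by rewrite (ord1 x) (ord1 y).
move=> [x|[[|[|[|//]]] x]] [y|[[|[|[|//]]] y]];
  rewrite /f ?GP2_spoke ?GP2_irr // ?GP2_outer ?add0r ?addNr;
  by rewrite ?[0 == _]eq_sym ?[1 == - 1]eq_sym ?eqxx ?one0 ?oppE ?orbT.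
Qed.

(** * The matching and dominating set of period five *)

Section PeriodFive.
Hypothesis dvd5k : (5 %| k)%N.

Definition residue (i : 'I_k) : nat := i %% 5.

(** As 5 divides k, wrapping around modulo k preserves residues modulo 5. *)
Lemma residue_add i c : residue (i + c%:R) = ((residue i + c) %% 5)%N.
Proof. by rewrite /residue Zp_nat /= modnDmr modn_dvdm // modnDml. Qed.

Lemma residue_sub i c :
  (c <= 5)%N -> residue (i - c%:R) = ((residue i + (5 - c)) %% 5)%N.
Proof.
move=> c5; rewrite -[in RHS](subrK c%:R i) residue_add modnDml -addnA subnKC //.
by rewrite modnDr modn_mod.
Qed.

Definition partner (x : 'I_k + 'I_k) : 'I_k + 'I_k :=
  match x with
  | inl i => match residue i with
             | 0 => inl (i + 1) | 1 => inl (i - 1) | 3 => inr i | _ => inl i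
             end
  | inr i => match residue i with
             | 2 => inr (i + 2%:R) | 4 => inr (i - 2%:R) | 3 => inl i | _ => inr i
             end
  end.

(** One end of each matching edge, so that the same set yields both upper bounds. *)
Definition dominators : {set 'I_k + 'I_k} :=
  [set x | match x with
           | inl i => (residue i == 0%N) || (residue i == 3%N)
           | inr i => residue i == 4%N
           end].

Lemma residue_lt5 i : (residue i < 5)%N. Proof. exact: ltn_pmod. Qed.

Lemma residue1D i : residue (i + 1) = ((residue i + 1) %% 5)%N.
Proof. exact: (residue_add i 1). Qed.

Lemma residue1B i : residue (i - 1) = ((residue i + 4) %% 5)%N.
Proof. exact: (residue_sub i 1). Qed.

Lemma partnerK : involutive partner.
Proof.
case=> i; case r: (residue i) (residue_lt5 i) => [|[|[|[|[|//]]]]] _;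
  by rewrite /= r /= ?residue1D ?residue1B ?residue_add ?residue_sub ?r //=
             ?addrK ?subrK.
Qed.

Lemma card_dominators : (5 * #|dominators| = 3 * k)%N.
Proof.
pose F (r : nat) : nat := (((r == 0) || (r == 3)) + (r == 4))%N.
have -> : #|dominators| = (\sum_(i < k) F (i %% 5))%N.
  rewrite -sum1_card big_mkcond big_sumType /= -big_split /=.
  apply: eq_bigr => i _; rewrite !inE /F /residue.
  by congr (_ + _)%N; case: (_ || _) (_ == _) => [] [].
rewrite (sum_periodic k 5 F dvd5k).
have -> : (\sum_(r < 5) F r = 3)%N by rewrite !big_ord_recl big_ord0.
by rewrite mulnC.
Qed.

Lemma dominating_dominators : dominating G dominators.
Proof.
apply/forallP=> x; apply/implyP=> xS; apply/exists_inP.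
case: x xS => i; rewrite inE;
  case r: (residue i) (residue_lt5 i) => [|[|[|[|[|//]]]]] _ // _.
- by exists (inl (i - 1)); rewrite ?GP2_outer ?subrK ?eqxx ?orbT // inE residue1B r.
- by exists (inl (i + 1)); rewrite ?GP2_outer ?eqxx // inE residue1D r.
- by exists (inr i); rewrite ?GP2_spoke ?eqxx // inE r.
- by exists (inl i); rewrite ?GP2_spoke ?eqxx // inE r.
- by exists (inr (i - 2%:R)); rewrite ?GP2_inner ?subrK ?eqxx ?orbT // inE residue_sub // r.
- by exists (inr (i + 2%:R)); rewrite ?GP2_inner ?eqxx // inE residue_add r.
- by exists (inl i); rewrite ?GP2_spoke ?eqxx // inE r.
Qed.

Lemma partner_neq x : (partner x != x) =
  match x with
  | inl i => residue i \notin [:: 2; 4]%N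
  | inr i => residue i \notin [:: 0; 1]%N
  end.
Proof.
have addE c (i : 'I_k) : (0 < c < 5)%N -> (i + c%:R != i) * (i - c%:R != i).
  move=> c5; split; [|rewrite subr_eq eq_sym];
    by rewrite -subr_eq0 addrAC subrr add0r natr_ord_neq0.
case: x => i; case r: (residue i) (residue_lt5 i) => [|[|[|[|[|//]]]]] _;
  rewrite /partner r.
- by rewrite (inj_eq inl_inj) (addE 1).
- by rewrite (inj_eq inl_inj) (addE 1).
- by rewrite eqxx.
- by [].
- by rewrite eqxx.
- by rewrite eqxx.
- by rewrite eqxx.
- by rewrite (inj_eq inr_inj) (addE 2).
- by [].
- by rewrite (inj_eq inr_inj) (addE 2).
Qed.

Lemma partner_edge x : partner x != x -> G x (partner x).
Proof.
rewrite partner_neq; case: x => i;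
  case r: (residue i) (residue_lt5 i) => [|[|[|[|[|//]]]]] _ // _;
  by rewrite /partner r ?GP2_outer ?GP2_inner ?GP2_spoke ?subrK ?eqxx ?orbT.
Qed.

Lemma partner_dominators x :
  partner x != x -> (x \in dominators) || (partner x \in dominators).
Proof.
rewrite partner_neq; case: x => i;
  case r: (residue i) (residue_lt5 i) => [|[|[|[|[|//]]]]] _ // _;
  by rewrite /partner r !inE ?residue1D ?residue1B ?residue_add ?residue_sub ?r.
Qed.

Lemma dominators_partner x : x \in dominators -> partner x != x.
Proof.
rewrite partner_neq inE; case: x => i;
 by case r: (residue i) (residue_lt5 i) => [|[|[|[|[|//]]]]] _.
Qed.

(** The fixed vertices have residues 2, 4 on the outer cycle and 0, 1 inside. Outer edges shift
    residues by 1, inner ones by 2, and spokes preserve them, so no edge joins two fixed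
    vertices. *)
Lemma partner_cover x y : G x y -> (partner x != x) || (partner y != y).
Proof.
rewrite !partner_neq; case: x y => i [j|j].
- rewrite GP2_outer => /orP[]/eqP->; rewrite residue1D.
    by case: (residue i) (residue_lt5 i) => [|[|[|[|[|//]]]]].
  by case: (residue j) (residue_lt5 j) => [|[|[|[|[|//]]]]].
- by rewrite GP2_spoke => /eqP->; case: (residue j) (residue_lt5 j) => [|[|[|[|[|//]]]]].
- by rewrite GP2_spoke => /eqP->; case: (residue j) (residue_lt5 j) => [|[|[|[|[|//]]]]].
- rewrite GP2_inner => /orP[]/eqP->; rewrite residue_add.
    by case: (residue i) (residue_lt5 i) => [|[|[|[|[|//]]]]].
  by case: (residue j) (residue_lt5 j) => [|[|[|[|[|//]]]]].
Qed.

End PeriodFive.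

End GP2.

Theorem proposition8 :
  (forall k : nat, 5 <= k -> has_induced claw (GP2 k)) /\
  (forall k : nat, 5 <= k -> 5 %| k ->
     domination_number (GP2 k) = edge_domination_number (GP2 k) /\
     ((edge_domination_number (GP2 k))%:R = 3%:R / 5%:R * k%:R :> rat)%R).
Proof.
split=> [[|[|k]] // k_ge5|[|[|k]] // k_ge5 k5]; first exact: GP2_has_claw.
have [S domS cardS] := domination_number_witness _ (GP2 k.+2).
have domLB : 3 * k.+2 <= 5 * domination_number (GP2 k.+2).
  by rewrite -cardS; apply: dominating_GP2_leq.
have domUB : domination_number (GP2 k.+2) <= #|dominators k|.
  by apply: domination_number_leq; apply: dominating_dominators.
have irr := GP2_irr k_ge5.
(* With degree 3 and $2k$ vertices this reads $3 \cdot 2k \le 5 \cdot 2\gamma_e$. *)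
have edgeLB := regular_edge_domination _ _ (@GP2_sym _) irr 2 (GP2_cubic _ k_ge5).
rewrite card_sum !card_ord in edgeLB.
have edgeUB : edge_domination_number (GP2 k.+2) <= #|dominators k|.
  apply: (edge_domination_involution _ _ (partner k)).
  - exact: partnerK.
  - exact: partner_edge.
  - exact: partner_dominators.
  - exact: dominators_partner.
  - exact: partner_cover.
have cardD := card_dominators _ k5.
have edgeE : 5 * edge_domination_number (GP2 k.+2) = 3 * k.+2 by lia.
have domE : 5 * domination_number (GP2 k.+2) = 3 * k.+2 by lia.
split; first by apply/eqP; rewrite -(@eqn_pmul2l 5) // domE edgeE.
apply: (@mulfI rat 5%:R%R) => //.
by rewrite -natrM edgeE natrM mulrA mulrCA mulfV ?mulr1.
Qed.
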